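(* Let $T,n_a\ge1$. For $\imath\in\{i,i+1\}$ and $k=1,\dots,T$ let $\hat{\mathbf{\Sigma}}_k^{\frac12\imath}\in\mathbb{R}^{n_a\times n_a}$, $\hat{\mathbf{\Sigma}}_k^{\imath}=(\hat{\mathbf{\Sigma}}_k^{\frac12\imath})^\top\hat{\mathbf{\Sigma}}_k^{\frac12\imath}$, $\hat{\boldsymbol\sigma}_k^{\imath}=\mathrm{vec}(\hat{\mathbf{\Sigma}}_k^{\frac12\imath})$ and $\hat{\boldsymbol\sigma}^{\imath}=\mathrm{col}(\hat{\boldsymbol\sigma}_1^{\imath},\dots,\hat{\boldsymbol\sigma}_T^{\imath})$. Suppose $$\hat{\boldsymbol\sigma}^{i+1}=\mathcal{I}_\Sigma\,\hat{\boldsymbol\sigma}^{i}$$ for a matrix $\mathcal{I}_\Sigma\in\mathbb{R}^{Tn_a^2\times Tn_a^2}$ satisfying $\mathbf{0}\le\mathcal{I}_\Sigma\le\mathbf{I}$. Let $\sigma_{k,1}^{\imath},\dots,\sigma_{k,n_a}^{\imath}$ be the singular values of $\hat{\mathbf{\Sigma}}_k^{\imath}$ for $\imath=i,i+1$. Then $$\sum_{k=1}^T\sum_{p=1}^{n_a}\sigma_{k,p}^{i+1}\ \le\ \sum_{k=1}^T\sum_{p=1}^{n_a}\sigma_{k,p}^{i}.$$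
   Context: $\hat{\mathbf{\Sigma}}_k^{\imath}$ is the covariance matrix of a Gaussian control policy at time step $k$ and iteration $\imath$, with square-root factor $\hat{\mathbf{\Sigma}}_k^{\frac12\imath}$. $\mathrm{vec}$ stacks the columns of a matrix; $\mathrm{col}$ stacks vectors. The matrix inequalities $\mathbf{0}\le\mathcal{I}_\Sigma\le\mathbf{I}$ are in the Loewner (positive semidefinite) order on symmetric matrices, so $\mathcal{I}_\Sigma$ is symmetric. *)

(* Defs.v *)
From mathcomp Require Import all_boot all_order all_algebra.
From mathcomp Require Import reals.

Set Implicit Arguments.
Unset Strict Implicit.
Unset Printing Implicit Defensive.

Import Order.TTheory GRing.Theory Num.Theory.
Local Open Scope ring_scope.

(* mxvec concatenates the rows of a matrix into a row vector, so stacking the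
   columns of A amounts to applying mxvec to the transpose of A. *)
Definition vec (R : realType) (m n : nat) (A : 'M[R]_(m, n)) : 'cV[R]_(n * m) :=
  (mxvec A^T)^T.

(* The k-th row of the intermediate matrix is (v k)^T; concatenating these rows
   with mxvec and transposing puts v 0, v 1, ... on top of each other. *)
Definition col_stack (R : realType) (T m : nat) (v : 'I_T -> 'cV[R]_m) :
    'cV[R]_(T * m) :=
  (mxvec (\matrix_(k < T) (v k)^T))^T.

Definition psdmx (R : realType) (n : nat) (A : 'M[R]_n) : Prop :=
  A \is symmetricmx /\ forall x : 'cV[R]_n, 0 <= (x^T *m A *m x) 0 0.

Definition loewner_le (R : realType) (n : nat) (A B : 'M[R]_n) : Prop :=
  [/\ A \is symmetricmx, B \is symmetricmx & psdmx (B - A)].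

(* The s p are the nonnegative square roots of the eigenvalues of A^T *m A,
   listed with their algebraic multiplicities. No order is imposed on them. *)
Definition singular_values (R : realType) (n : nat) (A : 'M[R]_n)
    (s : 'I_n -> R) : Prop :=
  (forall p, 0 <= s p) /\
  char_poly (A^T *m A) = \prod_(p < n) ('X - (s p ^+ 2)%:P).

(* Main.v *)
Require Import Defs.
From mathcomp Require Import all_boot all_order all_algebra.
From mathcomp Require Import reals.

Set Implicit Arguments.
Unset Strict Implicit.
Unset Printing Implicit Defensive.

Import Order.TTheory GRing.Theory Num.Theory.
Local Open Scope ring_scope.

(** Since [Sigma = F^T F] is positive semidefinite, its singular values are its
    eigenvalues, so they add up to the trace of [Sigma], which is the squared
    Euclidean norm of [vec F]. Summing over [k] gives the squared norm of the
    stacked vector, which a matrix between [0] and [I] does not increase.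

    No spectral theorem is needed: from
    [det (x - A) det (x + A) = det (x^2 - A^2)] the characteristic polynomials
    of [A] and [- A] both divide [prod_p (x - s_p) (x + s_p)], hence split.
    Comparing roots, the absolute values of the eigenvalues of [A] and [- A]
    add up to [2 sum_p s_p]. *)

Lemma char_poly_mulN (R : comNzRingType) (n : nat) (A : 'M[R]_n) :
  char_poly A * char_poly (- A) = char_poly (A *m A) \Po 'X^2.
Proof.
rewrite /char_poly -det_mulmx.
(* Substituting ['X^2] is a ring morphism, so it passes through the determinant to the entries of
   [char_poly_mx]. *)
rewrite -[RHS](det_map_mx (comp_poly 'X^2)).
congr (\det _); rewrite /char_poly_mx map_mxN opprK.
rewrite mulmxDr !mulmxBl -scalar_mxM -scalar_mxC -map_mxM.
rewrite addrA subrK; apply/matrixP => i j; rewrite !mxE.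
by rewrite rmorphB /= comp_polyC rmorphMn /= comp_polyX expr2.
Qed.

(** A divisor of a product of linear factors is associated to a subproduct, and equal to it when
    monic. The trace is then read off the coefficient of degree [n.-1]. *)
Lemma char_poly_split_trace (F : fieldType) (n : nat) (A : 'M[F]_n) (rs : seq F) :
  char_poly A %| \prod_(r <- rs) ('X - r%:P) ->
  exists2 ts, char_poly A = \prod_(t <- ts) ('X - t%:P) & \sum_(t <- ts) t = \tr A.
Proof.
move=> /dvdp_prod_XsubC[m]; set ts := mask m rs.
rewrite eqp_monic ?char_poly_monic ?monic_prod_XsubC // => /eqP Ats.
exists ts => //.
have size_ts : size ts = n.
  by apply: succn_inj; rewrite -(size_prod_XsubC ts id) -Ats size_char_poly.
(* For [n = 0] there is no such coefficient; both sums are empty. *)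
have [n0|n_gt0] := posnP n.
  rewrite (size0nil (etrans size_ts n0)) big_nil /mxtrace big1 // => i.
  by have := ltn_ord i; rewrite [X in (_ < X)%N]n0.
apply: oppr_inj; rewrite -char_poly_trace // Ats.
by rewrite -coefPn_prod_XsubC size_ts // -lt0n.
Qed.

(** A row eigenvector [v] gives [v A v^T = a |v|^2] with [|v|^2 > 0]. *)
Lemma psd_eigenvalue_ge0 (R : realType) (n : nat) (A : 'M[R]_n) (a : R) :
  psdmx A -> eigenvalue A a -> 0 <= a.
Proof.
move=> [_ A_ge0] /eigenvalueP[v Av v0].
have := A_ge0 v^T; rewrite trmxK Av -scalemxAl mxE.
suff v_gt0 : 0 < (v *m v^T) 0 0 by rewrite pmulr_lge0.
have -> : (v *m v^T) 0 0 = \sum_j v 0 j ^+ 2.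
  by rewrite mxE; apply: eq_bigr => j _; rewrite mxE expr2.
rewrite lt_def sumr_ge0 ?andbT; last by move=> j _; exact: sqr_ge0.
apply: contraNneq v0 => /psumr_eq0P v_eq0; apply/eqP/rowP => j.
by rewrite mxE; apply/eqP; rewrite -sqrf_eq0 v_eq0 // => k _; exact: sqr_ge0.
Qed.

Lemma symmetricmx_tr (R : fieldType) (n : nat) (A : 'M[R]_n) :
  A \is symmetricmx -> A^T = A.
Proof.
by move=> /is_hermitianmxP; rewrite expr0 scale1r map_mx_id // => <-.
Qed.

Lemma psd_sum_singular_values (R : realType) (n : nat) (A : 'M[R]_n) (s : 'I_n -> R) :
  psdmx A -> singular_values A s -> \sum_p s p = \tr A.
Proof.
move=> psdA [s_ge0]; rewrite (symmetricmx_tr psdA.1) => Es.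
pose rs := [seq s p | p <- index_enum _] ++ [seq - s p | p <- index_enum _].
have Ers : char_poly A * char_poly (- A) = \prod_(r <- rs) ('X - r%:P).
  rewrite char_poly_mulN Es rmorph_prod /= big_cat !big_map /=.
  rewrite -big_split /=; apply: eq_bigr => p _.
  by rewrite comp_polyB comp_polyX comp_polyC rmorphN rmorphXn /= opprK subr_sqr.
have [ts Ets sum_ts] : exists2 ts, char_poly A = \prod_(t <- ts) ('X - t%:P)
    & \sum_(t <- ts) t = \tr A.
  by apply: (@char_poly_split_trace _ _ _ rs); rewrite -Ers dvdp_mulr.
have [us Eus sum_us] : exists2 us, char_poly (- A) = \prod_(u <- us) ('X - u%:P)
    & \sum_(u <- us) u = \tr (- A).
  by apply: (@char_poly_split_trace _ _ _ rs); rewrite -Ers dvdp_mull.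
(* Unique factorization: both lists are the roots, with multiplicity, of the same product. *)
have perm_roots : perm_eq (ts ++ us) rs.
  by apply: prod_XsubC_eq; rewrite big_cat /= -Ets -Eus.
have ts_ge0 t : t \in ts -> 0 <= t.
  move=> t_in; apply: psd_eigenvalue_ge0 psdA _.
  by rewrite eigenvalue_root_char Ets root_prod_XsubC.
have us_le0 u : u \in us -> u <= 0.
  move=> u_in; rewrite -oppr_ge0; apply: psd_eigenvalue_ge0 psdA _.
  have : eigenvalue (- A) u by rewrite eigenvalue_root_char Eus root_prod_XsubC.
  move=> /eigenvalueP[v vA v0]; apply/eigenvalueP; exists v => //.
  by rewrite scaleNr -vA mulmxN opprK.
have : \sum_(r <- ts ++ us) `|r| = \sum_(r <- rs) `|r| by exact: perm_big.
(* The signs of [ts] and [us] are known, so the sum is [tr A - tr (- A)]. *)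
have -> : \sum_(r <- ts ++ us) `|r| = \tr A *+ 2.
  rewrite big_cat /= (eq_big_seq id) => [|t t_in]; last by rewrite ger0_norm ?ts_ge0.
  rewrite sum_ts (eq_big_seq -%R) => [|u u_in]; last by rewrite ler0_norm ?us_le0.
  by rewrite sumrN sum_us linearN /= opprK mulr2n.
have -> : \sum_(r <- rs) `|r| = (\sum_p s p) *+ 2.
  rewrite big_cat !big_map /= mulr2n.
  by congr (_ + _); apply: eq_bigr => p _; rewrite ?normrN ger0_norm.
by move/eqP; rewrite eqrMn2r //= => /eqP.
Qed.

Lemma gram_ge0 (R : realType) (n : nat) (x : 'cV[R]_n) : 0 <= (x^T *m x) 0 0.
Proof.
by rewrite mxE sumr_ge0 // => i _; rewrite mxE -expr2 sqr_ge0.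
Qed.

Lemma psd_gram (R : realType) (m n : nat) (F : 'M[R]_(m, n)) : psdmx (F^T *m F).
Proof.
split=> [|x].
  by apply/is_hermitianmxP; rewrite expr0 scale1r map_mx_id // trmx_mul trmxK.
by rewrite mulmxA -trmx_mul -mulmxA gram_ge0.
Qed.

(** Both sides are the sum of the squared entries of [A]. *)
Lemma mxvec_gram (R : comNzRingType) (m n : nat) (A : 'M[R]_(m, n)) :
  (mxvec A *m (mxvec A)^T) 0 0 = \tr (A *m A^T).
Proof.
have -> : \tr (A *m A^T) = \sum_i \sum_j A i j * A i j.
  by apply: eq_bigr => i _; rewrite mxE; apply: eq_bigr => j _; rewrite mxE.
rewrite mxE (reindex _ (curry_mxvec_bij m n)) pair_bigA /=.
by apply: eq_bigr => -[i j] _; rewrite mxE !mxvecE.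
Qed.

Lemma col_stack_vec_gram (R : realType) (T m n : nat) (F : 'I_T -> 'M[R]_(m, n)) :
  let x := col_stack (fun k => vec (F k)) in
  (x^T *m x) 0 0 = \sum_k \tr ((F k)^T *m F k).
Proof.
rewrite /= /col_stack trmxK mxvec_gram; apply: eq_bigr => k _.
rewrite -{2}[F k]trmxK -mxvec_gram !mxE.
by apply: eq_bigr => j _; rewrite !mxE.
Qed.

(** With [y = M x] and [z = x - y], [|x|^2 = |y|^2 + 2 y.z + |z|^2], so it suffices that
    [y.z >= 0]. *)
Lemma loewner_unit_contraction (R : realType) (n : nat) (M : 'M[R]_n) (x : 'cV[R]_n) :
  loewner_le 0 M -> loewner_le M 1%:M ->
  ((M *m x)^T *m (M *m x)) 0 0 <= (x^T *m x) 0 0.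
Proof.
move=> [_ symM]; rewrite subr0 => -[_ M_ge0] [_ _ [_ IM_ge0]].
set y := M *m x; set z := x - y.
have yz : x = y + z by rewrite addrC subrK.
have Ey : y^T = x^T *m M by rewrite trmx_mul (symmetricmx_tr symM).
have yz_ge0 : 0 <= (y^T *m z) 0 0.
  (* M (I - M) = M (I - M) M + (I - M) M (I - M) *)
  have -> : y^T *m z = y^T *m (1%:M - M) *m y + z^T *m M *m z.
    (* [M] is symmetric and commutes with [1 - M]. *)
    have zM : z^T *m M = y^T *m (1%:M - M).
      by rewrite linearB /= mulmxBl -Ey mulmxBr mulmx1.
    rewrite zM -mulmxDr -yz -mulmxA; congr (_ *m _).
    by rewrite mulmxBl mul1mx.
  by rewrite mxE addr_ge0.
(* A 1 by 1 matrix equals its transpose. *)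
have zy : z^T *m y = y^T *m z.
  by rewrite [LHS]mx11_scalar [RHS]mx11_scalar -{1}[z^T *m y]trmxK trmx_mul trmxK mxE.
clearbody z y; rewrite yz [(y + z)^T]linearD /= mulmxDl !mulmxDr zy.
move: yz_ge0 (gram_ge0 z).
move: (y^T *m y) (y^T *m z) (z^T *m z) => a b c b_ge0 c_ge0.
by rewrite !mxE -addrA lerDl !addr_ge0.
Qed.

Theorem theoremV4 (R : realType) (T na : nat) (hT : (1 <= T)%N) (hna : (1 <= na)%N)
  (* square-root factors, covariances and singular values at iterations i, i+1 *)
  (F F' : 'I_T -> 'M[R]_na) (Sigma Sigma' : 'I_T -> 'M[R]_na)
  (hSigma : forall k, Sigma k = (F k)^T *m F k)
  (hSigma' : forall k, Sigma' k = (F' k)^T *m F' k)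
  (I_Sigma : 'M[R]_(T * (na * na)))
  (hI0 : loewner_le 0 I_Sigma) (hI1 : loewner_le I_Sigma 1%:M)
  (hupd : col_stack (fun k => vec (F' k)) =
          I_Sigma *m col_stack (fun k => vec (F k)))
  (sigma sigma' : 'I_T -> 'I_na -> R)
  (hsigma : forall k, singular_values (Sigma k) (sigma k))
  (hsigma' : forall k, singular_values (Sigma' k) (sigma' k)) :
  \sum_(k < T) \sum_(p < na) sigma' k p <= \sum_(k < T) \sum_(p < na) sigma k p.
Proof.
have sumE (G S : 'I_T -> 'M[R]_na) (s : 'I_T -> 'I_na -> R) :
    (forall k, S k = (G k)^T *m G k) -> (forall k, singular_values (S k) (s k)) ->
    let x := col_stack (fun k => vec (G k)) in
    \sum_(k < T) \sum_(p < na) s k p = (x^T *m x) 0 0.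
  move=> SE s_sv; rewrite /= col_stack_vec_gram; apply: eq_bigr => k _.
  by rewrite -SE; apply: psd_sum_singular_values => //; rewrite SE; exact: psd_gram.
rewrite (sumE _ _ _ hSigma hsigma) (sumE _ _ _ hSigma' hsigma') hupd.
exact: loewner_unit_contraction.
Qed.
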